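(* Consider a source, a destination and $M \geq 1$ relays. Let $a_{sd}$, $a_{si}$, $a_{id}$ ($i=1,\dots,M$) be mutually independent circularly symmetric complex Gaussian $\mathcal{CN}(0,1)$ channel gains (source to destination, source to relay $i$, relay $i$ to destination). Let the best relay $b$ be the index maximizing $\min\{|a_{si}|^2,|a_{id}|^2\}$, with gains $a_{sb}, a_{bd}$. Let $\rho>0$ be the SNR, $r\in(0,1/2)$ the multiplexing gain and $R = r\log\rho$ the code rate. Under opportunistic amplify-and-forward, the mutual information between source and destination is $$I = \tfrac12\log\bigl(1+\rho|a_{sd}|^2 + f(\rho|a_{sb}|^2, \rho|a_{bd}|^2)\bigr),\qquad f(x,y) = \frac{xy}{x+y+1},$$ and the outage probability is $P_e(\rho) = \Pr(I \leq R)$. Then opportunistic amplify-and-forward achieves the diversity-multiplexing tradeoff $d(r) = (M+1)(1-2r)$ for $r\in(0,1/2)$, where $d(r) = -\lim_{\rho\to\infty}\frac{\log P_e(\rho)}{\log\rho}$.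
   Context: Setting: the source transmits in the first half of the time slots; only the best relay (selected by the rule: largest $\min\{|a_{si}|^2,|a_{id}|^2\}$) amplifies and retransmits its received signal in the second half (orthogonal slots, half duplex); the destination combines the direct and relayed copies with a matched filter, with an i.i.d. Gaussian codebook. No channel knowledge is used at the physical layer. *)

(* Defs.v *)
From HB Require Import structures.
From mathcomp Require Import all_boot all_order all_algebra.
From mathcomp Require Import all_classical all_reals all_analysis.
Set Implicit Arguments. Unset Strict Implicit. Unset Printing Implicit Defensive.
Import Order.TTheory GRing.Theory Num.Theory.
Local Open Scope classical_set_scope.
Local Open Scope ring_scope.

Definition chan (M : nat) := option ('I_M * bool).
Definition ch_sd {M : nat} : chan M := None.
Definition ch_si {M : nat} (i : 'I_M) : chan M := Some (i, false).
Definition ch_id {M : nat} (i : 'I_M) : chan M := Some (i, true).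

(* Mutual independence of a finite family of real random variables:
   product rule for all families of Borel sets (taking B i = setT recovers
   every subfamily). *)
Definition mutually_independent {d} {T : measurableType d} {R : realType}
  (P : probability T R) {I : finType} (X : I -> T -> R) : Prop :=
  forall B : I -> set R, (forall i, measurable (B i)) ->
    P (\bigcap_(i in [set: I]) (X i @^-1` B i)) =
    (\prod_(i : I) P (X i @^-1` B i))%E.

(* X has law N(m, s^2) (s = standard deviation). *)
Definition has_normal_law {d} {T : measurableType d} {R : realType}
  (P : probability T R) (X : T -> R) (m s : R) : Prop :=
  forall A : set R, measurable A -> P (X @^-1` A) = normal_prob m s A.

(* A complex gain a = Re + i Im is circularly symmetric CN(0,1) with all
   gains mutually independent iff the 2(2M+1) real/imaginary parts are
   mutually independent, each N(0, 1/2). Index (c, false) = Re a_c,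
   (c, true) = Im a_c. *)
Definition iid_CN01_gains {d} {T : measurableType d} {R : realType}
  (P : probability T R) {M : nat} (X : chan M * bool -> T -> R) : Prop :=
  mutually_independent P X /\
  forall k, has_normal_law P (X k) 0 (Num.sqrt (2^-1)).

Definition gain2 {T} {R : realType} {M : nat} (X : chan M * bool -> T -> R)
  (c : chan M) (t : T) : R := X (c, false) t ^+ 2 + X (c, true) t ^+ 2.

Definition famp {R : realType} (x y : R) : R := x * y / (x + y + 1).

Definition best_relay {T} {R : realType} {M : nat} (hM : (0 < M)%N)
  (X : chan M * bool -> T -> R) (t : T) : 'I_M :=
  [arg max_(i > Ordinal hM) Num.min (gain2 X (ch_si i) t) (gain2 X (ch_id i) t)]%O.

Definition oaf_mutual_info {T} {R : realType} {M : nat} (hM : (0 < M)%N)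
  (X : chan M * bool -> T -> R) (rho : R) (t : T) : R :=
  let b := best_relay hM X t in
  2^-1 * ln (1 + rho * gain2 X ch_sd t
              + famp (rho * gain2 X (ch_si b) t) (rho * gain2 X (ch_id b) t)).

Definition outage_prob {d} {T : measurableType d} {R : realType}
  (P : probability T R) {M : nat} (hM : (0 < M)%N)
  (X : chan M * bool -> T -> R) (r rho : R) : R :=
  fine (P [set t | oaf_mutual_info hM X rho t <= r * ln rho]).

(* Main.v *)
(* An outage forces every path to be weak: with u = rho^(2r) and
   eps = u / rho, the direct gain is at most 3 eps, and so is the smaller of
   the two gains of the best relay, hence of every relay.  So for one of the
   2^M choices of a hop per relay, M + 1 independent gains are O(eps).
   Conversely, if the direct gain and all source-relay gains are at most
   eps / 4, there is an outage.  A CN(0,1) squared gain is O(eps) when its two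
   Gaussian coordinates are O(sqrt eps), so it is small with probability of
   order eps; both bounds are therefore of order
   eps^(M+1) = rho^(-(M+1)(1-2r)). *)

Require Import Defs.
From HB Require Import structures.
From mathcomp Require Import all_boot all_order all_algebra.
From mathcomp Require Import all_classical all_reals all_analysis.
From mathcomp Require Import measurable_realfun ring lra.
Import Order.TTheory GRing.Theory Num.Theory.
Import numFieldNormedType.Exports.
Local Open Scope classical_set_scope.
Local Open Scope ring_scope.

(** * Exponents of polynomially decaying functions *)

Lemma cvg_ln_pinfty (R : realType) : @ln R x @[x --> +oo] --> +oo.
Proof.
apply/cvgryPge => A; near=> x.
have Ax : expR A <= x by near: x; exact: nbhs_pinfty_ge (num_real _).
by rewrite -(expRK A) ler_ln ?posrE ?expR_gt0// (lt_le_trans _ Ax) ?expR_gt0.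
Unshelve. all: by end_near. Qed.

(** Taking [- ln] and dividing by [ln x] turns the constants into the corrections [ln A / ln x] and
    [ln B / ln x], which vanish at infinity, so the quotient is squeezed to [D]. *)
Lemma cvg_decay_exponent (R : realType) (p : R -> R) (A B D : R) :
  0 < A -> 0 < B ->
  (\forall x \near +oo,
     A * expR (- (D * ln x)) <= p x <= B * expR (- (D * ln x))) ->
  - ln (p x) / ln x @[x --> +oo] --> D.
Proof.
move=> A0 B0 pAB.
have ln_gt0 : \forall x \near +oo, 0 < @ln R x.
  by have /cvgryPgt := @cvg_ln_pinfty R; apply.
have lnV0 : (@ln R x)^-1 @[x --> +oo] --> 0.
  by apply/(gtr0_cvgV0 ln_gt0); exact: cvg_ln_pinfty.
have lim c : (D - c * (ln x)^-1) @[x --> +oo] --> D.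
  rewrite -[X in _ --> X]subr0; apply: cvgB; first exact: cvg_cst.
  by rewrite -(mulr0 c); apply: cvgMr.
apply: (squeeze_cvgr _ (lim (ln B)) (lim (ln A))).
near=> x.
have lnx0 : 0 < ln x by near: x.
have /andP[Ap pB] : A * expR (- (D * ln x)) <= p x <= B * expR (- (D * ln x)).
  by near: x.
have p0 : 0 < p x by apply: lt_le_trans Ap; rewrite mulr_gt0 ?expR_gt0.
have lnE C : 0 < C -> ln (C * expR (- (D * ln x))) = ln C - D * ln x.
  by move=> C0; rewrite lnM ?posrE ?expR_gt0// expRK.
have lA : ln A - D * ln x <= ln (p x).
  by rewrite -lnE// ler_ln ?posrE ?mulr_gt0 ?expR_gt0.
have lB : ln (p x) <= ln B - D * ln x.
  by rewrite -lnE// ler_ln ?posrE ?mulr_gt0 ?expR_gt0.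
rewrite ler_pdivlMr// ler_pdivrMr// !mulrBl -!mulrA mulVf ?gt_eqF// !mulr1.
by apply/andP; split; lra.
Unshelve. all: by end_near. Qed.

(** * Gaussian mass of small intervals *)

(** The interval has length [2 * a], and the density there is at most its peak. As long as [a <= 1],
    it is also at least its value at 1. *)
Lemma normal_prob_sym_itv (R : realType) (s : R) : s != 0 ->
  exists c C : R, [/\ 0 < c, 0 < C & forall a, 0 < a ->
    fine (normal_prob 0 s `[- a, a]) <= C * a /\
    (a <= 1 -> c * a <= fine (normal_prob 0 s `[- a, a]))].
Proof.
move=> s0.
have muE (a : R) : 0 < a -> lebesgue_measure (`[- a, a] : set R) = (2 * a)%:E.
  move=> a0; rewrite lebesgue_measure_itv/= lte_fin ifT; last lra.
  by rewrite -EFinD; congr EFin; ring.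
have fin (a : R) : normal_prob 0 s `[- a, a] \is a fin_num.
  exact: (fin_num_measure (normal_prob 0 s)).
have pdf1 : 0 < normal_pdf 0 s 1.
  by rewrite normal_pdfE// mulr_gt0 ?normal_peak_gt0 ?expR_gt0.
have pk := normal_peak_gt0 s0.
exists (normal_pdf 0 s 1 * 2), (normal_peak s * 2).
split; rewrite ?mulr_gt0// => a a0; split.
  rewrite -lee_fin fineK// /normal_prob -mulrA EFinM -muE//.
  rewrite -integral_cst//; apply: ge0_le_integral => //= [x _||x _].
  - by rewrite lee_fin normal_pdf_ge0.
  - apply/measurable_EFinP; apply: measurable_funTS.
    exact: measurable_normal_pdf.
  by rewrite lee_fin normal_pdf_ub.
move=> a1; rewrite -lee_fin fineK// /normal_prob -mulrA EFinM -muE//.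
rewrite -integral_cst//; apply: ge0_le_integral => //= [x _||x].
- by rewrite lee_fin normal_pdf_ge0.
- apply/measurable_EFinP; apply: measurable_funTS.
  exact: measurable_normal_pdf.
rewrite in_itv/= => xa; rewrite lee_fin !normal_pdfE// ler_pM2l//.
rewrite ler_expR !mulNr lerN2 ler_wpM2r//.
  by rewrite invr_ge0 mulrn_wge0// sqr_ge0.
by rewrite !subr0; nra.
Qed.

(** * Cubes of independent coordinates, union bound, measurability of arg max *)

(** The product rule speaks of all coordinates at once; those outside [S] are given the set [setT]
    and contribute a factor 1. *)
Lemma independent_prob_cube d (T : measurableType d) (R : realType)
    (P : probability T R) (K : finType) (X : K -> T -> R) (A : set R) (q : R)
    (S : {set K}) :
  mutually_independent P X -> measurable A ->
  (forall k, P (X k @^-1` A) = q%:E) ->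
  P [set t | forall k, k \in S -> A (X k t)] = (q ^+ #|S|)%:E.
Proof.
move=> indX mA XA.
have := indX (fun k => if k \in S then A else setT).
have -> : \bigcap_(k in [set: K]) X k @^-1` (if k \in S then A else setT) =
    [set t | forall k, k \in S -> A (X k t)].
  apply/seteqP; split=> t /= XS k.
    by move=> kS; have := XS k I; rewrite /preimage/= kS.
  by move=> _; rewrite /preimage/=; case: ifPn => // /XS.
move=> -> => [|k]; last by case: ifP.
rewrite (eq_bigr (fun k => if k \in S then q%:E else 1%E)); last first.
  by move=> k _; case: ifP => // _; rewrite preimage_setT probability_setT.
rewrite -big_mkcond/= big_const; elim: #|_| => //= n ->.
by rewrite exprS EFinM.
Qed.

Lemma measurable_cube d (T : measurableType d) (R : realType)
    (K : finType) (X : K -> T -> R) (A : set R) (S : {set K}) :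
  (forall k, measurable_fun setT (X k)) -> measurable A ->
  measurable [set t | forall k, k \in S -> A (X k t)].
Proof.
move=> mX mA.
have -> : [set t | forall k, k \in S -> A (X k t)] =
    \bigcap_(k in [set` S]) X k @^-1` A by [].
apply: fin_bigcap_measurable => [|k _]; first exact: finite_finset.
by rewrite -[X in measurable X]setTI; exact: mX.
Qed.

Lemma measure_bigsetU_le d (T : measurableType d) (R : realType)
    (mu : {measure set T -> \bar R}) (I : Type) (s : seq I) (F : I -> set T) :
  (forall i, measurable (F i)) ->
  (mu (\big[setU/set0]_(i <- s) F i) <= \sum_(i <- s) mu (F i))%E.
Proof.
move=> mF; elim: s => [|i s IH]; first by rewrite !big_nil measure0.
rewrite !big_cons (le_trans (measureU2 _ _ _))//.
  exact: bigsetU_measurable.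
exact: leeD2l.
Qed.

(* The arg max is a function of the set of maximisers, of which there are
   finitely many. *)
Lemma measurable_arg_max d (T : measurableType d) (R : realType)
    (I : finType) (i0 i : I) (F : I -> T -> R) :
  (forall j, measurable_fun setT (F j)) ->
  measurable [set t | [arg max_(j > i0) F j t]%O = i].
Proof.
move=> mF.
pose S t := [set j | [forall k, F k t <= F j t]]%SET.
(* [g] repeats the definition of arg max, default [i0] included, so the two agree by unfolding. *)
pose g (S : {set I}) := odflt i0 [pick j | j \in S].
have argE t : [arg max_(j > i0) F j t]%O = g (S t).
  by rewrite /Order.arg_max /extremum /g; congr odflt; apply: eq_pick => j /=; rewrite inE.
have mle k j : measurable [set t | F k t <= F j t].
  by rewrite -[X in measurable X]setTI; exact: measurable_fun_le.
have mmax j : measurable [set t | j \in S t].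
  have -> : [set t | j \in S t] = \bigcap_(k in [set: I]) [set t | F k t <= F j t].
    apply/seteqP; split=> t /=.
      by rewrite inE => /forallP H k _; exact: H.
    by move=> H; rewrite inE; apply/forallP => k; exact: H.
  by apply: fin_bigcap_measurable => // ; exact: finite_finset.
have -> : [set t | [arg max_(j > i0) F j t]%O = i] =
    \bigcup_(A in [set A : {set I} | g A = i]) \bigcap_(j in [set: I])
      [set t | (j \in S t) = (j \in A)].
  apply/seteqP; split=> t /=; rewrite argE.
    by move=> gi; exists (S t).
  move=> [A /= gA SA]; rewrite -gA; congr g; apply/setP => j; exact: SA.
apply: fin_bigcup_measurable => [|A _]; first exact: finite_finset.
apply: fin_bigcap_measurable => [|j _]; first exact: finite_finset.
case: (j \in A); first exact: mmax.
have -> : [set t | (j \in S t) = false] = ~` [set t | j \in S t].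
  by apply/seteqP; split=> t /= /negP; [|move/negbTE].
exact: measurableC.
Qed.

(** * Coordinates of the direct channel and of one hop per relay *)

Section OpportunisticRelaying.
Context {R : realType} {M : nat} (hM : (0 < M)%N).

(** [None] stands for the direct channel; [phi i] selects the hop of relay [i], [false] being source
    to relay. Both the real and the imaginary part of each selected gain are taken. *)
Definition branch_coords (phi : 'I_M -> bool) : {set chan M * bool} :=
  [set (omap (fun i => (i, phi i)) p.1, p.2) | p : option 'I_M * bool]%SET.

Lemma card_branch_coords phi : #|branch_coords phi| = (M.+1 * 2)%N.
Proof.
rewrite card_imset; first by rewrite card_prod card_option card_ord card_bool.
by move=> [[i|] c] [[j|] c'] //= [] => [-> _|] ->.
Qed.

Lemma branch_coords_sd phi c : (ch_sd, c) \in branch_coords phi.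
Proof. by apply/imsetP; exists (None, c). Qed.

Lemma branch_coords_relay phi i c : (Some (i, phi i), c) \in branch_coords phi.
Proof. by apply/imsetP; exists (Some i, c). Qed.

(** * Inclusions between outage and cubes, for a fixed outcome *)

Section Outcome.
Context {T : Type} (X : chan M * bool -> T -> R).

Lemma gain2_ge0 c t : 0 <= gain2 X c t.
Proof. by rewrite addr_ge0 ?sqr_ge0. Qed.

(** A disc lies in its circumscribed square; this reduces weak gains to small Gaussian
    coordinates. *)
Lemma gain2_le_coord c b t (e : R) : gain2 X c t <= e ->
  X (c, b) t \in `[- Num.sqrt e, Num.sqrt e].
Proof.
move=> Xe; have e0 := le_trans (gain2_ge0 c t) Xe.
rewrite in_itv/= -ler_norml -sqrtr_sqr ler_wsqrtr// (le_trans _ Xe)//.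
by case: b; rewrite ?lerDl ?lerDr sqr_ge0.
Qed.

Lemma coord_le_gain2 c t a : (forall b, X (c, b) t \in `[- a, a]) ->
  gain2 X c t <= 2 * a ^+ 2.
Proof.
move=> Xa; have sq b : X (c, b) t ^+ 2 <= a ^+ 2.
  by have := Xa b; rewrite in_itv/= => /andP[? ?]; nra.
by rewrite mulr_natl mulr2n lerD.
Qed.

(* Clearing denominators in [famp] also avoids the measurability of
   division. *)
Lemma oaf_outageE (r rho : R) t : 0 < rho ->
  let b := best_relay hM X t in
  let x := rho * gain2 X (ch_si b) t in
  let y := rho * gain2 X (ch_id b) t in
  (oaf_mutual_info hM X rho t <= r * ln rho) =
  ((1 + rho * gain2 X ch_sd t) * (x + y + 1) + x * y
     <= expR (2 * r * ln rho) * (x + y + 1)).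
Proof.
move=> rho0 b x y; rewrite /oaf_mutual_info -/b -/x -/y.
have x0 : 0 <= x by rewrite mulr_ge0 ?gain2_ge0// ltW.
have y0 : 0 <= y by rewrite mulr_ge0 ?gain2_ge0// ltW.
have w0 : 0 <= rho * gain2 X ch_sd t by rewrite mulr_ge0 ?gain2_ge0// ltW.
have D0 : 0 < x + y + 1 by rewrite ltr_wpDl// addr_ge0.
have f0 : 0 <= famp x y by apply: divr_ge0; [exact: mulr_ge0|exact: ltW].
rewrite ler_pdivrMl// -[in RHS](ler_pM2r (x := (x + y + 1)^-1)) ?invr_gt0//.
rewrite [2 * (_ * _)]mulrA [X in _ = (X <= _)]mulrDl !mulfK ?gt_eqF//.
rewrite -/(famp x y).
by rewrite -[in LHS](expRK (2 * r * ln rho)) ler_ln ?posrE ?expR_gt0//; lra.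
Qed.

Lemma oaf_outage_sub (r rho : R) t : 0 < rho -> 0 <= r * ln rho ->
  let e := 3 * expR (2 * r * ln rho) / rho in
  oaf_mutual_info hM X rho t <= r * ln rho ->
  exists phi : {ffun 'I_M -> bool}, forall k, k \in branch_coords phi ->
    X k t \in `[- Num.sqrt e, Num.sqrt e].
Proof.
move=> rho0 rln0 e; rewrite oaf_outageE//.
have : 1 <= expR (2 * r * ln rho) by rewrite -[leLHS]expR0 ler_expR -mulrA mulr_ge0.
move: @e; set u := expR _ => e u1.
have scale c : (rho * gain2 X c t <= 3 * u) = (gain2 X c t <= e).
  by rewrite /e ler_pdivlMr// mulrC.
have nonneg c : 0 <= rho * gain2 X c t by rewrite mulr_ge0 ?gain2_ge0// ltW.
set b := best_relay hM X t.
have := nonneg ch_sd; have := nonneg (ch_si b); have := nonneg (ch_id b).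
set w := rho * gain2 X ch_sd t; set x := rho * gain2 X (ch_si b) t.
set y := rho * gain2 X (ch_id b) t.
move=> y0 x0 w0 out.
have D0 : 0 < x + y + 1 by lra.
have sd_e : gain2 X ch_sd t <= e.
  rewrite -scale -/w; have xy0 := mulr_ge0 x0 y0.
  have : 1 + w <= u by rewrite -(ler_pM2r D0); lra.
  by lra.
have xy_u : x * y <= u * (x + y + 1).
  by have : 0 <= (1 + w) * (x + y + 1) by [apply: mulr_ge0; lra]; lra.
have b_e : Num.min (gain2 X (ch_si b) t) (gain2 X (ch_id b) t) <= e.
  rewrite ge_min -!scale -/x -/y.
  (* If both [x] and [y] exceeded [3 * u], hence 1, then [x + y + 1] would be at most three times
     the larger one. The outage bound [xy_u] would then push the smaller one down to [3 * u]; this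
     is the origin of the factor 3. *)
  have [//|x3] := leP x (3 * u).
  have [//|y3] := leP y (3 * u).
  have [xy|yx] := leP x y.
    have : u * (x + y + 1) <= u * (3 * y) by rewrite ler_pM2l; lra.
    have : 3 * u * y < x * y by rewrite ltr_pM2r; lra.
    by lra.
  have : u * (x + y + 1) <= u * (3 * x) by rewrite ler_pM2l; lra.
  have : x * (3 * u) < x * y by rewrite ltr_pM2l; lra.
  by lra.
(* The second hop is chosen exactly when the first is strong. Maximality of [b] carries [b_e] over
   to every relay, so the chosen hop is weak. *)
exists [ffun i => e < gain2 X (ch_si i) t] => k /imsetP[[[i|] c] _ ->] /=;
  last exact: gain2_le_coord.
apply: gain2_le_coord; rewrite ffunE.
have : Num.min (gain2 X (ch_si i) t) (gain2 X (ch_id i) t) <= e.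
  apply: le_trans b_e; rewrite /b /best_relay.
  by case: arg_maxP => // j _; exact.
by rewrite ge_min; case: ltP => [_ /=|//].
Qed.

(** Since [famp x y <= x], weak source-relay hops suffice, whichever relay is selected. The 8 in [a]
    makes each such scaled gain at most [u / 4], and [1 + u / 4 + u / 4 <= u] once [2 <= u]. *)
Lemma oaf_outage_sup (r rho : R) t : 0 < rho -> 2 <= expR (2 * r * ln rho) ->
  let a := Num.sqrt (expR (2 * r * ln rho) / rho / 8) in
  (forall k, k \in branch_coords (fun=> false) -> X k t \in `[- a, a]) ->
  oaf_mutual_info hM X rho t <= r * ln rho.
Proof.
move=> rho0 + a Xa; rewrite oaf_outageE//.
move: @a Xa; set u := expR _ => a Xa u2.
have small c : (forall d, (c, d) \in branch_coords (fun=> false)) ->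
    rho * gain2 X c t <= u / 4.
  move=> cS; have := coord_le_gain2 _ _ _ (fun d => Xa _ (cS d)).
  rewrite sqr_sqrtr; last by rewrite !divr_ge0 ?expR_ge0 ?ltW.
  rewrite -(ler_pM2l rho0) => /le_trans; apply; rewrite le_eqVlt; apply/orP; left.
  by apply/eqP; field; rewrite gt_eqF.
set b := best_relay hM X t.
have := small _ (branch_coords_sd _).
have := small _ (branch_coords_relay (fun=> false) b).
have nonneg c : 0 <= rho * gain2 X c t by rewrite mulr_ge0 ?gain2_ge0// ltW.
have := nonneg ch_sd; have := nonneg (ch_si b); have := nonneg (ch_id b).
set w := rho * gain2 X ch_sd t; set x := rho * gain2 X (ch_si b) t.
set y := rho * gain2 X (ch_id b) t.
by move=> y0 x0 w0 xu wu; nra.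
Qed.

End Outcome.

(** * Measurability of the outage event *)

Lemma measurable_gain2 d (T : measurableType d) (X : chan M * bool -> T -> R) c :
  (forall k, measurable_fun setT (X k)) -> measurable_fun setT (gain2 X c).
Proof. by move=> mX; apply: measurable_funD; exact: measurable_funX. Qed.

(** The selected relay varies with the outcome, so the event is cut along its finitely many values;
    on each piece outage is a polynomial inequality in the gains. *)
Lemma measurable_oaf_outage d (T : measurableType d)
    (X : chan M * bool -> T -> R) (r rho : R) :
  (forall k, measurable_fun setT (X k)) -> 0 < rho ->
  measurable [set t | oaf_mutual_info hM X rho t <= r * ln rho].
Proof.
move=> mX rho0.
pose x i t := rho * gain2 X (ch_si i) t; pose y i t := rho * gain2 X (ch_id i) t.
pose lhs i t := (1 + rho * gain2 X ch_sd t) * (x i t + y i t + 1) + x i t * y i t.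
pose rhs i t := expR (2 * r * ln rho) * (x i t + y i t + 1).
have -> : [set t | oaf_mutual_info hM X rho t <= r * ln rho] =
    \bigcup_(i in [set: 'I_M])
      ([set t | best_relay hM X t = i] `&` [set t | lhs i t <= rhs i t]).
  apply/seteqP; split=> t /=; rewrite oaf_outageE//.
    by move=> out; exists (best_relay hM X t).
  by move=> [i _ [<-]].
have mg c : measurable_fun setT (fun t => rho * gain2 X c t).
  by apply: measurable_funM => //; exact: measurable_gain2.
have mD i : measurable_fun setT (fun t => x i t + y i t + 1).
  by apply: measurable_funD => //; apply: measurable_funD; exact: mg.
apply: fin_bigcup_measurable => [|i _]; first exact: finite_finset.
apply: measurableI.
  apply: measurable_arg_max => j.
  by apply: measurable_minr; exact: measurable_gain2.
rewrite -[X in measurable X]setTI; apply: measurable_fun_le => //.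
  apply: measurable_funD; apply: measurable_funM => //; try exact: mg.
  by apply: measurable_funD => //; exact: mg.
exact: measurable_funM.
Qed.

End OpportunisticRelaying.

(** * The outage exponent *)

Theorem theorem4 (R : realType) (d : measure_display) (T : measurableType d)
  (P : probability T R) (M : nat) (hM : (0 < M)%N)
  (X : chan M * bool -> {RV P >-> R})
  (hX : iid_CN01_gains P (fun k => (X k : T -> R)))
  (r : R) (hr : 0 < r < 2^-1) :
  (fun rho : R => - ln (outage_prob P hM (fun k => (X k : T -> R)) r rho) / ln rho)
    @ +oo --> (M%:R + 1) * (1 - 2 * r).
Proof.
have [indX lawX] := hX; have /andP[r0 r12] := hr.
set s : R := Num.sqrt 2^-1 in lawX.
have s0 : s != 0 by rewrite gt_eqF// sqrtr_gt0 invr_gt0.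
have [c [C [c0 C0 cC]]] := normal_prob_sym_itv _ _ s0.
pose q a := fine (normal_prob 0 s `[- a, a]).
pose Y k : T -> R := X k.
have mY k : measurable_fun setT (Y k) by exact: measurable_funPT.
have PY a k : P (Y k @^-1` `[- a, a]) = (q a)%:E.
  rewrite lawX// fineK//; exact: (fin_num_measure (normal_prob 0 s)).
pose cube a phi := [set t | forall k, k \in branch_coords phi ->
    Y k t \in `[- a, a]].
have mcube a phi : measurable (cube a phi).
  by apply: (@measurable_cube _ _ _ _ Y [set` `[- a, a]]).
have Pcube a phi : P (cube a phi) = (q a ^+ (M.+1 * 2))%:E.
  rewrite -(card_branch_coords phi).
  by apply: (@independent_prob_cube _ _ _ P _ Y [set` `[- a, a]]).
have q0 a : 0 <= q a by rewrite fine_ge0.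
pose out rho := [set t | oaf_mutual_info hM Y rho t <= r * ln rho].
have mout rho : 0 < rho -> measurable (out rho).
  by move=> ?; exact: measurable_oaf_outage.
(* Lower constant: one cube of half-side [sqrt (eps / 8)]. Upper constant: [2 ^ M] cubes of
   half-side [sqrt (3 * eps)]. Each cube constrains [2 * (M + 1)] coordinates. *)
apply: (@cvg_decay_exponent _ _ ((c ^+ 2 / 8) ^+ M.+1)
  (2 ^+ M * (C ^+ 2 * 3) ^+ M.+1)).
- by rewrite exprn_gt0// divr_gt0// exprn_gt0.
- by rewrite mulr_gt0 ?exprn_gt0// mulr_gt0// exprn_gt0.
near=> rho.
have rho1 : 1 < rho by near: rho; exact: nbhs_pinfty_gt (num_real _).
(* This threshold gives [rho^(2r) >= 2], as the lower inclusion requires. *)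
have ln_large : ln 2 / (2 * r) <= ln rho.
  by near: rho; have /cvgryPge := @cvg_ln_pinfty R; apply.
have rho0 : 0 < rho by lra.
have ln0 : 0 < ln rho by rewrite ln_gt0.
have u2 : 2 <= expR (2 * r * ln rho).
  rewrite -[leLHS]lnK ?posrE// ler_expR.
  by rewrite mulrC -ler_pdivrMr// mulr_gt0.
have epsE : expR (2 * r * ln rho) / rho = expR (- ((1 - 2 * r) * ln rho)).
  by rewrite -[X in _ / X]lnK ?posrE// -expRN -expRD; congr expR; ring.
set eps := _ / rho in epsE.
have eps0 : 0 < eps by rewrite epsE expR_gt0.
(* Here [r < 1/2] enters; the bound keeps the half-side of the lower cube below 1, where the
   Gaussian lower bound holds. *)
have eps1 : eps <= 1.
  by rewrite epsE -[leRHS]expR0 ler_expR oppr_le0 mulr_ge0//; lra.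
have -> : expR (- ((M%:R + 1) * (1 - 2 * r) * ln rho)) = eps ^+ M.+1.
  by rewrite epsE -expRM_natl; congr expR; rewrite -natr1; ring.
have Pfin : P (out rho) \is a fin_num by apply: fin_num_measure; exact: mout.
(* The two real coordinates of each gain pair up, so the square roots disappear and the exponent
   becomes [M + 1]. *)
have sqrt_pow (k e : R) : 0 <= e ->
    (k * Num.sqrt e) ^+ (M.+1 * 2) = (k ^+ 2 * e) ^+ M.+1.
  by move=> e0; rewrite mulnC exprM [(_ * _) ^+ 2]exprMn sqr_sqrtr.
apply/andP; split; rewrite -lee_fin /outage_prob fineK//.
- set a := Num.sqrt (eps / 8).
  have a0 : 0 < a by rewrite sqrtr_gt0 divr_gt0.
  have a1 : a <= 1 by rewrite -sqrtr1 ler_wsqrtr//; lra.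
  apply: (@le_trans _ _ (P (cube a (fun=> false)))); last first.
    apply: le_measure; rewrite ?inE//; first exact: mout.
    by move=> t; exact: oaf_outage_sup.
  rewrite Pcube lee_fin -exprMn mulrAC -mulrA -sqrt_pow; last by rewrite divr_ge0 ?ltW.
  apply: lerXn2r; rewrite ?nnegrE//; first by rewrite mulr_ge0 ?ltW.
  by have [_] := cC _ a0; exact.
- set e := 3 * expR (2 * r * ln rho) / rho.
  set a := Num.sqrt e.
  have eE : e = 3 * eps by rewrite /e /eps mulrA.
  have e0 : 0 < e by rewrite eE mulr_gt0.
  have a0 : 0 < a by rewrite sqrtr_gt0.
  (* Union bound over the [2 ^ M] choices of a weak hop for each relay. *)
  apply: (@le_trans _ _ (\sum_(phi : {ffun 'I_M -> bool}) P (cube a phi))%E).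
    apply: (@le_trans _ _
        (P (\big[setU/set0]_(phi : {ffun 'I_M -> bool}) cube a phi))); last first.
      exact: measure_bigsetU_le.
    apply: le_measure; rewrite ?inE//; first exact: mout.
      exact: bigsetU_measurable.
    move=> t outt.
    have rln0 := ltW (mulr_gt0 r0 ln0).
    have [phi tphi] := oaf_outage_sub _ _ _ _ _ rho0 rln0 outt.
    by rewrite -bigcup_seq; exists phi => //=; rewrite mem_index_enum.
  rewrite (eq_bigr (fun=> (q a ^+ (M.+1 * 2))%:E)) => [|phi _]; last exact: Pcube.
  rewrite sumEFin lee_fin sumr_const card_ffun card_bool card_ord.
  rewrite -[leLHS]mulr_natl natrX -mulrA ler_wpM2l ?exprn_ge0//.
  rewrite -exprMn -mulrA -eE -sqrt_pow; last exact: ltW.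
  apply: lerXn2r; rewrite ?nnegrE//; first by rewrite mulr_ge0 ?ltW.
  by have [] := cC _ a0.
Unshelve. all: by end_near. Qed.
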